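(* In the setting of the context, let $f:\mathcal{D}_{I_1}\times\cdots\times\mathcal{D}_{I_r}\to D/J$ be a polynomial function. Let $S=\{\mathbf{k}=(k_1,\ldots,k_r)\in\mathbb{N}^r:\ k_i<\mu(I_i,J)\text{ for all }1\le i\le r\}$. Then there exist coefficients $b_{\mathbf{k}}\in R$ ($\mathbf{k}\in S$), only finitely many nonzero, such that $F=\sum_{\mathbf{k}\in S}b_{\mathbf{k}}(\mathbf{x})_{\mathbf{k}}\in R[x_1,\ldots,x_r]$ represents $f$. Moreover, the coefficients are uniquely determined modulo the ideals $\operatorname{Ann}_J\big(v_{k_1}(X_1)\cdots v_{k_r}(X_r)\big)$: if $(b'_{\mathbf{k}})_{\mathbf{k}\in S}$ is another finitely supported family in $R$, then $\sum_{\mathbf{k}\in S}b'_{\mathbf{k}}(\mathbf{x})_{\mathbf{k}}$ also represents $f$ if and only if $b_{\mathbf{k}}-b'_{\mathbf{k}}\in\operatorname{Ann}_J\big(v_{k_1}(X_1)\cdots v_{k_r}(X_r)\big)$ for every $\mathbf{k}=(k_1,\ldots,k_r)\in S$.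
   Context: Standing setting. $D$ is a Dedekind domain, $r\ge1$, and $I_1,\ldots,I_r,J$ are ideals of $D$ different from $0$ and $D$. For each $i$ a complete set of residues $\mathcal{D}_{I_i}\subseteq D$ modulo $I_i$ with $0\in\mathcal{D}_{I_i}$ is fixed, identified with $D/I_i$. Let $K=\operatorname{lcm}[I_1,\ldots,I_r,J]=I_1\cap\cdots\cap I_r\cap J$ and $R=D/K$; for an ideal $I\supseteq K$ of $D$ write $\bar I=I/K\subseteq R$, so $R/\bar J\cong D/J$. Let $X_i\subseteq R$ be the image of $\mathcal{D}_{I_i}$ under $D\to R$ (the map is injective on $\mathcal{D}_{I_i}$, so $|X_i|=|D/I_i|$). Write $K=P_1^{e_1}\cdots P_n^{e_n}$ with distinct primes $P_l$ and $e_l\ge1$; the nonzero prime ideals of $R$ are $\bar P_1,\ldots,\bar P_n$. $P$-orderings. For a nonzero prime $\bar P$ of $R$ and $a\in R$, $w_{\bar P}(a)$ denotes the highest power of $\bar P$ containing $a$ (with $w_{\bar P}(0)$ the zero ideal); powers of $\bar P$ are totally ordered by inclusion. For a nonempty subset $X\subseteq R$, a $\bar P$-ordering of $X$ is a sequence $b_0,b_1,\ldots$ in $X$ with $b_0$ arbitrary and, for $k\ge1$, $b_k\in X$ chosen so that $w_{\bar P}\big((b_k-b_0)\cdots(b_k-b_{k-1})\big)$ is as large as possible (minimal exponent of $\bar P$). Its $\bar P$-sequence is $v_0(X,\bar P)=R$, $v_k(X,\bar P)=w_{\bar P}\big((b_k-b_0)\cdots(b_k-b_{k-1})\big)$ for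 $k\ge1$; it does not depend on the chosen $\bar P$-ordering, and for every $a\in X$ one has $w_{\bar P}((a-b_0)\cdots(a-b_{k-1}))\subseteq v_k(X,\bar P)$. The factorial ideals are $v_k(X)=\prod_{l=1}^n v_k(X,\bar P_l)$ (so $v_0(X)=R$, and $v_k(X)=0$ for $k\ge|X|$ if $X$ is finite). Fixed sequences. For each $i$ and $l$ fix a $\bar P_l$-ordering $(a_{l,i,j})_{j\in\mathbb{N}}$ of $X_i$ with $a_{l,i,0}=0$, and let $a_{i,j}\in R$ be the element with $a_{i,0}=0$ and $a_{i,j}\equiv a_{l,i,j}\pmod{\bar P_l^{e_l}}$ for all $l$ (Chinese Remainder Theorem). Then $v_k(X_i)=\langle (a_{i,k}-a_{i,0})\cdots(a_{i,k}-a_{i,k-1})\rangle$. For $\mathbf{k}=(k_1,\ldots,k_r)\in\mathbb{N}^r$ put $(\mathbf{x})_{\mathbf{k}}=\prod_{i=1}^r (x_i)_{k_i}$ where $(x_i)_0=1$ and $(x_i)_{k}=\prod_{j=0}^{k-1}(x_i-a_{i,j})$ for $k\ge1$. Further notation. $\mu(I_i,J)$ is the smallest positive integer $k$ with $v_k(X_i)\subseteq\bar J$ if such $k$ exists, and $|D/I_i|$ otherwise (possibly infinite). For an ideal $I$ of $R$, $\operatorname{Ann}_J(I)=\{b\in R: bI\subseteq\bar J\}$. Polynomial functions. A function $f:\mathcal{D}_{I_1}\times\cdots\times\mathcal{D}_{I_r}\to D/J$ is a polynomial function if some $F\in D[x_1,\ldots,x_r]$ satisfies $F(b)\equiv f(b)\pmod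 J$ for all $b\in\mathcal{D}_{I_1}\times\cdots\times\mathcal{D}_{I_r}$. A polynomial $F\in R[x_1,\ldots,x_r]$ represents $f$ if for every $b=(b_1,\ldots,b_r)\in\mathcal{D}_{I_1}\times\cdots\times\mathcal{D}_{I_r}$, the value of $F$ at the images of $b_1,\ldots,b_r$ in $R$ maps to $f(b)$ under $R\to R/\bar J=D/J$. *)

(* Defs.v *)
From HB Require Import structures.
From mathcomp Require Import all_boot all_order all_algebra.
From mathcomp Require Import fraction.
Set Implicit Arguments. Unset Strict Implicit. Unset Printing Implicit Defensive.
Import GRing.Theory.
Local Open Scope ring_scope.

Section IdealsOfD.
Variable D : idomainType.

Definition ideal_of (I : D -> Prop) : Prop :=
  [/\ I 0, (forall x y, I x -> I y -> I (x - y)) & (forall c x, I x -> I (c * x))].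
Definition unit_ideal : D -> Prop := fun _ => True.
Definition zero_ideal : D -> Prop := fun x => x = 0.
Definition ideal_sub (I J : D -> Prop) : Prop := forall x, I x -> J x.
Definition ideal_eq (I J : D -> Prop) : Prop := forall x, I x <-> J x.
Definition proper_nonzero (I : D -> Prop) : Prop :=
  [/\ ideal_of I, ~ ideal_eq I zero_ideal & ~ I 1].
Definition ideal_add (I J : D -> Prop) : D -> Prop :=
  fun x => exists y z, [/\ I y, J z & x = y + z].
Definition ideal_mul (I J : D -> Prop) : D -> Prop :=
  fun x => exists s : seq (D * D),
    (forall p, p \in s -> I p.1 /\ J p.2) /\ x = \sum_(p <- s) p.1 * p.2.
Definition ideal_exp (I : D -> Prop) (m : nat) : D -> Prop :=
  iter m (ideal_mul I) unit_ideal.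
Definition ideal_prod (s : seq (D -> Prop)) : D -> Prop :=
  foldr ideal_mul unit_ideal s.
Definition prime_ideal (P : D -> Prop) : Prop :=
  [/\ ideal_of P, ~ P 1 & forall x y, P (x * y) -> P x \/ P y].

Definition fin_gen (I : D -> Prop) : Prop :=
  exists s : seq D, forall x,
    I x <-> exists c : 'I_(size s) -> D, x = \sum_(i < size s) c i * s`_i.
Definition noetherian : Prop := forall I, ideal_of I -> fin_gen I.
Definition integrally_closed : Prop :=
  forall (x : {fraction D}) (p : {poly D}),
    p \is monic -> root (map_poly (@tofrac D) p) x -> exists d : D, x = @tofrac D d.
Definition nonzero_primes_maximal : Prop :=
  forall P, prime_ideal P -> ~ ideal_eq P zero_ideal ->
    forall Q, ideal_of Q -> ideal_sub P Q -> ideal_eq Q P \/ Q 1.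
Definition dedekind : Prop :=
  [/\ noetherian, integrally_closed & nonzero_primes_maximal].

Definition residue_system (I X : D -> Prop) : Prop :=
  X 0 /\ forall d, exists x, [/\ X x, I (d - x) & forall y, X y -> I (d - y) -> y = x].

Definition lcm_ideal (r : nat) (I : 'I_r -> D -> Prop) (J : D -> Prop) : D -> Prop :=
  fun x => (forall i, I i x) /\ J x.

(* "k < |X|" for a possibly infinite subset X of D *)
Definition lt_card (X : D -> Prop) (k : nat) : Prop :=
  exists s : seq D, [/\ uniq s, size s = k.+1 & forall x, x \in s -> X x].

End IdealsOfD.
Arguments unit_ideal {D} _.
Arguments zero_ideal {D} _.

(* The ring R = D/K is represented by D itself, elements/ideals being read
   modulo K; ideals of R are the ideals of D containing K. *)
Section QuotientR.
Variables (D : idomainType) (K : D -> Prop).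

Definition Rmul (Q T : D -> Prop) : D -> Prop := ideal_add (ideal_mul Q T) K.
Definition Rexp (Q : D -> Prop) (m : nat) : D -> Prop := iter m (Rmul Q) unit_ideal.
Definition Rprod (s : seq (D -> Prop)) : D -> Prop := foldr Rmul unit_ideal s.

(* w_{\bar P}(a): the highest (= smallest) power of \bar P containing a,
   and the zero ideal of R (i.e. K) if a = 0 in R *)
Definition wP (P : D -> Prop) (a : D) : D -> Prop :=
  fun x => (K a -> K x) /\ (~ K a -> forall m, Rexp P m a -> Rexp P m x).

Definition is_Pordering (P X : D -> Prop) (b : nat -> D) : Prop :=
  (forall k, X (b k)) /\
  forall k a, X a ->
    ideal_sub (wP P (\prod_(j < k) (a - b j))) (wP P (\prod_(j < k) (b k - b j))).

Definition vseqP (P : D -> Prop) (b : nat -> D) (k : nat) : D -> Prop :=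
  if k is 0 then unit_ideal else wP P (\prod_(j < k) (b k - b j)).

Definition vfact (n : nat) (P : 'I_n -> D -> Prop) (bl : 'I_n -> nat -> D)
    (k : nat) : D -> Prop :=
  Rprod [seq vseqP (P l) (bl l) k | l <- enum 'I_n].

(* "k < mu(I, J)" where v = v_.(X) and X = D_I *)
Definition lt_mu (v : nat -> D -> Prop) (J X : D -> Prop) (k : nat) : Prop :=
  let E := exists k0, (0 < k0)%N /\ ideal_sub (v k0) J in
  (E -> forall k', (0 < k')%N -> (k' <= k)%N -> ~ ideal_sub (v k') J) /\
  (~ E -> lt_card X k).

Definition annJ (J Q : D -> Prop) : D -> Prop := fun c => forall x, Q x -> J (c * x).

End QuotientR.

Section Polys.
Variables (D : idomainType) (r : nat).

Definition falling (a : 'I_r -> nat -> D) (i : 'I_r) (k : nat) (x : D) : D :=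
  \prod_(j < k) (x - a i j).
Definition mfalling (a : 'I_r -> nat -> D) (k : {ffun 'I_r -> nat}) (x : 'I_r -> D) : D :=
  \prod_(i < r) falling a i (k i) (x i).

Definition supported (b : {ffun 'I_r -> nat} -> D) (L : seq {ffun 'I_r -> nat}) : Prop :=
  forall k, k \notin L -> b k = 0.
Definition eval_family (a : 'I_r -> nat -> D) (b : {ffun 'I_r -> nat} -> D)
    (L : seq {ffun 'I_r -> nat}) (x : 'I_r -> D) : D :=
  \sum_(k <- undup L) b k * mfalling a k x.

Definition eval_mpoly (F : seq (D * {ffun 'I_r -> nat})) (x : 'I_r -> D) : D :=
  \sum_(m <- F) m.1 * \prod_(i < r) x i ^+ m.2 i.

Definition in_domain (Dres : 'I_r -> D -> Prop) (x : 'I_r -> D) : Prop :=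
  forall i, Dres i (x i).

(* f : D_{I_1} x ... x D_{I_r} -> D/J (values given by representatives in D) *)
Definition poly_function (J : D -> Prop) (Dres : 'I_r -> D -> Prop)
    (f : ('I_r -> D) -> D) : Prop :=
  exists F : seq (D * {ffun 'I_r -> nat}),
    forall x, in_domain Dres x -> J (eval_mpoly F x - f x).

Definition represents (J : D -> Prop) (Dres : 'I_r -> D -> Prop)
    (f : ('I_r -> D) -> D) (a : 'I_r -> nat -> D)
    (b : {ffun 'I_r -> nat} -> D) (L : seq {ffun 'I_r -> nat}) : Prop :=
  forall x, in_domain Dres x -> J (eval_family a b L x - f x).

End Polys.

(* Main.v *)
(** Put [A_l = P_l^{e_l}].  These ideals are pairwise comaximal with product [K],
    so membership in an ideal [J] containing [K] may be tested in each
    [J + A_l].  Modulo [A_l], the element [a i j] may be replaced by the term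
    [al l i j] of the P_l-ordering, and the ideal [v_k(X_i)] is generated by
    [d_{l,i,k} = \prod_(j < k) (al l i k - al l i j)], because [D/A_l] is a
    local principal ideal ring.  Hence [(x)_k] is a multiple of
    [\prod_i d_{l,i,k_i}] on the residue systems, which kills the terms outside
    [S] and shows that changing [b_k] by an element of the annihilator is
    harmless.  Conversely, evaluating a Newton sum at the point
    [(al l i k_i)_i] leaves only the terms with index at most [k], and by
    induction on [\sum_i k_i] each coefficient times [\prod_i d_{l,i,k_i}] lies in
    [J + A_l].  Existence is the Newton expansion of monomials. *)

Require Import Defs.
From mathcomp Require Import all_boot all_order all_algebra.
From mathcomp Require Import fraction.
From mathcomp Require Import boolp ring.
Set Implicit Arguments. Unset Strict Implicit.
Import GRing.Theory.
Local Open Scope ring_scope.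

(** * Ideals as predicates: congruences, products, comaximality, local membership *)

Section IdealArithmetic.
Variable D : idomainType.
Implicit Types (A B C M P : D -> Prop) (x y z : D).

Lemma ideal0 A : ideal_of A -> A 0. Proof. by case. Qed.

Lemma idealMull A c x : ideal_of A -> A x -> A (c * x).
Proof. by case=> _ _; apply. Qed.

Lemma idealMulr A c x : ideal_of A -> A x -> A (x * c).
Proof. by rewrite mulrC; apply: idealMull. Qed.

Lemma idealB A x y : ideal_of A -> A x -> A y -> A (x - y).
Proof. by case=> _ + _; apply. Qed.

Lemma idealN A x : ideal_of A -> A x -> A (- x).
Proof. by move=> iA Ax; rewrite -mulN1r; apply: idealMull. Qed.

Lemma idealD A x y : ideal_of A -> A x -> A y -> A (x + y).
Proof.
by move=> iA Ax Ay; rewrite -[y]opprK; apply: idealB => //; apply: idealN.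
Qed.

Lemma ideal_sum A (T : Type) (s : seq T) (Q : pred T) (F : T -> D) :
  ideal_of A -> (forall t, Q t -> A (F t)) -> A (\sum_(t <- s | Q t) F t).
Proof.
move=> iA AF; apply: big_ind => //; first exact: ideal0.
by move=> x y; apply: idealD.
Qed.

Lemma ideal_congr A x y : ideal_of A -> A (x - y) -> A y -> A x.
Proof. by move=> iA Axy Ay; rewrite -(subrK y x); apply: idealD. Qed.

Lemma congrMl A c x y : ideal_of A -> A (x - y) -> A (c * x - c * y).
Proof. by move=> iA Axy; rewrite -mulrBr; apply: idealMull. Qed.

Lemma congr_trans A y x z : ideal_of A -> A (x - y) -> A (y - z) -> A (x - z).
Proof.
move=> iA Axy Ayz; rewrite (_ : x - z = (x - y) + (y - z)); last by ring.
exact: idealD.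
Qed.

Lemma congr_sym A x y : ideal_of A -> A (x - y) -> A (y - x).
Proof. by move=> iA Axy; rewrite -opprB; apply: idealN. Qed.

Lemma congr_refl A x : ideal_of A -> A (x - x).
Proof. by move=> iA; rewrite subrr; apply: ideal0. Qed.

Lemma congrM A x x' y y' :
  ideal_of A -> A (x - x') -> A (y - y') -> A (x * y - x' * y').
Proof.
move=> iA Ax Ay.
rewrite (_ : _ - _ = y * (x - x') + x' * (y - y')); last by ring.
by apply: idealD => //; apply: idealMull.
Qed.

Lemma congr_prod A (T : Type) (s : seq T) (F G : T -> D) :
  ideal_of A -> (forall t, A (F t - G t)) ->
  A (\prod_(t <- s) F t - \prod_(t <- s) G t).
Proof.
move=> iA AFG; apply: (big_ind2 (fun x y => A (x - y))) => //.
  exact: congr_refl.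
by move=> *; apply: congrM.
Qed.

Lemma ideal_mul_min A B M : ideal_of M ->
  (forall x y, A x -> B y -> M (x * y)) -> ideal_sub (ideal_mul A B) M.
Proof.
move=> iM AB x [s [sP ->]]; rewrite big_seq; apply: ideal_sum => // p ps.
by case: (sP p ps); apply: AB.
Qed.

Lemma mem_ideal_mul A B x y : A x -> B y -> ideal_mul A B (x * y).
Proof.
move=> Ax By; exists [:: (x, y)]; rewrite big_seq1; split=> // p.
by rewrite inE => /eqP->.
Qed.

Lemma ideal_mul_ideal A B : ideal_of A -> ideal_of (ideal_mul A B).
Proof.
move=> iA; split.
- by exists [::]; rewrite big_nil.
- move=> _ _ [s [sP ->]] [t [tP ->]].
  exists (s ++ [seq (- p.1, p.2) | p <- t]); split.
    move=> p; rewrite mem_cat => /orP[/sP//|/mapP[q /tP[Aq Bq] ->]].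
    by split=> //; apply: idealN.
  rewrite big_cat big_map -sumrN /=; congr (_ + _).
  by apply: eq_bigr => p _; rewrite mulNr.
- move=> c _ [s [sP ->]]; exists [seq (c * p.1, p.2) | p <- s]; split.
    by move=> _ /mapP[q /sP[Aq Bq] ->]; split=> //; apply: idealMull.
  by rewrite big_map mulr_sumr; apply: eq_bigr => p _; rewrite mulrA.
Qed.

Lemma ideal_mul_subl A B : ideal_of A -> ideal_sub (ideal_mul A B) A.
Proof. by move=> iA; apply: ideal_mul_min => // x y Ax _; apply: idealMulr. Qed.

Lemma ideal_mul_subr A B : ideal_of B -> ideal_sub (ideal_mul A B) B.
Proof. by move=> iB; apply: ideal_mul_min => // x y _; apply: idealMull. Qed.

Lemma ideal_add_ideal A B :
  ideal_of A -> ideal_of B -> ideal_of (ideal_add A B).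
Proof.
move=> iA iB; split.
- by exists 0, 0; rewrite addr0; split=> //; apply: ideal0.
- move=> _ _ [x [y [Ax By ->]]] [x' [y' [Ax' By' ->]]].
  by exists (x - x'), (y - y'); split; [exact: idealB|exact: idealB|ring].
- move=> c _ [x [y [Ax By ->]]].
  by exists (c * x), (c * y); split; [exact: idealMull|exact: idealMull|ring].
Qed.

Lemma ideal_addl A B x : ideal_of B -> A x -> ideal_add A B x.
Proof. by move=> iB Ax; exists x, 0; rewrite addr0; split=> //; apply: ideal0. Qed.

Lemma ideal_addr A B x : ideal_of A -> B x -> ideal_add A B x.
Proof. by move=> iA Bx; exists 0, x; rewrite add0r; split=> //; apply: ideal0. Qed.

Lemma ideal_exp_ideal A m : ideal_of A -> ideal_of (ideal_exp A m).
Proof. by move=> iA; case: m => [|m] //; apply: ideal_mul_ideal. Qed.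

Lemma ideal_exp_le A m k :
  ideal_of A -> (m <= k)%N -> ideal_sub (ideal_exp A k) (ideal_exp A m).
Proof.
move=> iA; elim: k m => [|k IH] [|m] // mk.
apply: ideal_mul_min; first exact: ideal_exp_ideal.
by move=> x y Ax ky; apply: mem_ideal_mul => //; apply: IH ky.
Qed.

Lemma mem_ideal_exp A x m : A x -> ideal_exp A m (x ^+ m).
Proof. by move=> Ax; elim: m => [|m IH] //; rewrite exprS; apply: mem_ideal_mul. Qed.

Lemma ideal_prod_ideal (T : eqType) (s : seq T) (F : T -> D -> Prop) :
  (forall t, t \in s -> ideal_of (F t)) -> ideal_of (ideal_prod [seq F t | t <- s]).
Proof.
by case: s => [|t s] // iF; apply: ideal_mul_ideal; apply: iF; rewrite mem_head.
Qed.

Lemma ideal_prod_sub (T : eqType) (s : seq T) (F : T -> D -> Prop) t :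
  (forall t, ideal_of (F t)) -> t \in s ->
  ideal_sub (ideal_prod [seq F t | t <- s]) (F t).
Proof.
move=> iF; elim: s => [|u s IH] //=; rewrite inE => /orP[/eqP->|ts].
  exact: ideal_mul_subl.
move=> x Hx; apply: IH => //; apply: ideal_mul_subr Hx.
exact: ideal_prod_ideal.
Qed.

Definition comaximal A B := ideal_add A B 1.

Lemma comaximal_sym A B : comaximal A B -> comaximal B A.
Proof. by move=> [x [y [Ax By E]]]; exists y, x; rewrite addrC. Qed.

(** In the expansion of [1 = (a + b) * (a' + c)] every term except [b * c] lies in [A]. *)
Lemma comaximal_mul A B C :
  ideal_of A -> comaximal A B -> comaximal A C -> comaximal A (ideal_mul B C).
Proof.
move=> iA [a [b [Aa Bb E]]] [a' [c [Aa' Cc E']]].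
exists (a * (a' + c) + b * a'), (b * c); split.
- by apply: idealD => //; [apply: idealMulr|apply: idealMull].
- exact: mem_ideal_mul.
- have -> : 1 = (a + b) * (a' + c) by rewrite -E -E' mulr1.
  by ring.
Qed.

Lemma comaximal_unit A : ideal_of A -> comaximal A unit_ideal.
Proof. by move=> iA; exists 0, 1; split=> //; [exact: ideal0|rewrite add0r]. Qed.

Lemma comaximal_exp A B m : ideal_of A -> comaximal A B -> comaximal A (ideal_exp B m).
Proof.
move=> iA AB; elim: m => [|m IH]; first exact: comaximal_unit.
exact: comaximal_mul.
Qed.

Lemma comaximal_exp2 A B m k : ideal_of A -> ideal_of B ->
  comaximal A B -> comaximal (ideal_exp A m) (ideal_exp B k).
Proof.
move=> iA iB AB; apply: comaximal_exp; first exact: ideal_exp_ideal.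
by apply: comaximal_sym; apply: comaximal_exp => //; apply: comaximal_sym.
Qed.

Lemma comaximal_prod (T : eqType) (s : seq T) (F : T -> D -> Prop) A :
  ideal_of A -> (forall t, t \in s -> comaximal A (F t)) ->
  comaximal A (ideal_prod [seq F t | t <- s]).
Proof.
move=> iA; elim: s => [|t s IH] AF; first exact: comaximal_unit.
apply: comaximal_mul => //; first by apply: AF; rewrite mem_head.
by apply: IH => u us; apply: AF; rewrite inE us orbT.
Qed.

(** Induction on [s]: the product of the remaining factors lies in the colon ideal of [M] by [F t],
    so the induction hypothesis puts [x] there. It remains to split [1] between [F t] and the
    product of the other factors. *)
Lemma ideal_local (T : eqType) (s : seq T) (F : T -> D -> Prop) M x :
  (forall t, ideal_of (F t)) -> uniq s ->
  (forall t u, t != u -> comaximal (F t) (F u)) ->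
  ideal_of M -> ideal_sub (ideal_prod [seq F t | t <- s]) M ->
  (forall t, t \in s -> ideal_add M (F t) x) -> M x.
Proof.
move=> iF + cF; elim: s M => [|t s IH] M /=.
  by move=> _ iM sM _; apply: sM.
case/andP=> ts us iM sM xM.
have Ftx : forall y, F t y -> M (y * x).
  (* The induction is applied to the colon ideal of [M] by [F t]. *)
  apply: (IH (fun z => forall y, F t y -> M (y * z))) => //.
  - split=> [y _|z z' Mz Mz' y Fy|c z Mz y Fy].
    + by rewrite mulr0; apply: ideal0.
    + by rewrite mulrBr; apply: idealB; auto.
    + by rewrite mulrCA; apply: idealMull; auto.
  - by move=> z Fz y Fy; apply: sM; apply: mem_ideal_mul.
  - move=> u su; have [|m [z [Mm Fz ->]]] := xM u; first by rewrite inE su orbT.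
    by exists m, z; split=> // y _; apply: idealMull.
have [a [b [Fa sb E]]] : comaximal (F t) (ideal_prod [seq F t | t <- s]).
  apply: comaximal_prod => // u su; apply: cF.
  by apply: contraNneq ts => ->.
rewrite -[x]mul1r E mulrDl; apply: idealD => //; first exact: Ftx.
have [|m [z [Mm Fz ->]]] := xM t; first by rewrite mem_head.
rewrite mulrDr; apply: idealD => //; first exact: idealMull.
by apply: sM; rewrite mulrC; apply: mem_ideal_mul.
Qed.

End IdealArithmetic.

(** * Nonzero primes of a Dedekind domain and the local structure of their powers *)

Section Dedekind.
Variable D : idomainType.
Implicit Types (A B C M P : D -> Prop) (x y z : D).

(** Without a maximal member, choice yields a strictly increasing sequence, whose union is a
    finitely generated ideal. Indexing by [T] lets the condition bear on the index rather than on
    the ideal. *)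
Lemma noetherian_maximal (T : Type) (C : T -> Prop) (F : T -> D -> Prop) :
  noetherian D -> (forall t, C t -> ideal_of (F t)) -> (exists t, C t) ->
  exists2 t, C t & forall t', C t' -> ideal_sub (F t) (F t') -> ideal_sub (F t') (F t).
Proof.
move=> nD iF [t0 Ct0]; apply: contrapT => nmax.
(* Placing [C t] under the quantifier makes the statement total in [t], so [choice] returns a
   function that can be iterated. *)
have step t : exists t', C t ->
    [/\ C t', ideal_sub (F t) (F t') & exists2 x, F t' x & ~ F t x].
  have [Ct|] := pselect (C t); last by exists t.
  apply: contrapT => nt; apply: nmax; exists t => // t' Ct' tt' x Fx.
  by apply: contrapT => nFx; apply: nt; exists t' => _; split=> //; exists x.
have [g gP] := choice step.
pose u m := iter m g t0.
have Cu m : C (u m) by elim: m => //= m /gP[].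
have mono m k : (m <= k)%N -> ideal_sub (F (u m)) (F (u k)).
  elim: k => [|k IH]; first by rewrite leqn0 => /eqP->.
  rewrite leq_eqVlt => /orP[/eqP->//|/IH mk x /mk].
  by have [_ + _] := gP _ (Cu k); apply.
have iU : ideal_of (fun x => exists m, F (u m) x).
  split=> [|x y [m Fx] [k Fy]|c x [m Fx]].
  - by exists 0%N; apply: ideal0; apply: iF.
  - exists (maxn m k); apply: idealB; first exact: iF.
    + exact: mono (leq_maxl m k) _ Fx.
    + exact: mono (leq_maxr m k) _ Fy.
  - by exists m; apply: idealMull => //; apply: iF.
have [s sP] := nD _ iU.
have gen (i : 'I_(size s)) : exists m, F (u m) s`_i.
  apply/sP; exists (fun j => (j == i)%:R); rewrite (bigD1 i) //= eqxx mul1r big1 ?addr0 //.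
  by move=> j /negPf->; rewrite mul0r.
have [w wP] := choice gen.
(* All generators of the union already lie in stage [N], so stage [N.+1] cannot contain anything
   new. *)
pose N := \max_(i < size s) w i.
have [_ _ [x Fx []]] := gP _ (Cu N).
have /sP[c ->] : exists m, F (u m) x by exists N.+1.
apply: ideal_sum => [|i _]; first exact: iF.
apply: idealMull; first exact: iF.
by apply: mono (wP i); apply: (leq_bigmax i).
Qed.

(** The fraction [b / c] maps a nonzero finitely generated ideal into itself, so it is an eigenvalue
    of a matrix over [D], hence a root of its monic characteristic polynomial. *)
Lemma integrally_closed_stable A (b c : D) :
  integrally_closed D -> fin_gen A -> ~ ideal_eq A zero_ideal -> ideal_of A ->
  c != 0 -> (forall x, A x -> exists2 x', A x' & b * x = c * x') ->
  exists z, b = c * z.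
Proof.
move=> icD [s sP] nzA iA c0 stab.
have As (i : 'I_(size s)) : A s`_i.
  apply/sP; exists (fun j => (j == i)%:R).
  rewrite (bigD1 i) //= eqxx mul1r big1 ?addr0 //.
  by move=> j /negPf->; rewrite mul0r.
have row (i : 'I_(size s)) : exists mi : 'I_(size s) -> D, b * s`_i = c * \sum_j mi j * s`_j.
  by have [x' /sP[mi ->] E] := stab _ (As i); exists mi.
have [m mP] := choice row.
(* Transposed, so that the row of generators is a left eigenvector; it is nonzero because [A] is. *)
pose M := (\matrix_(i, j) m j i) : 'M[D]_(size s).
pose f := @tofrac D.
have fc0 : f c != 0 by rewrite tofrac_eq0.
have : root (map_poly f (char_poly M)) (f b / f c).
  rewrite map_char_poly -eigenvalue_root_char; apply/eigenvalueP.
  exists (\row_i f s`_i).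
    apply/rowP=> i; rewrite !mxE.
    apply: (mulfI fc0); rewrite [RHS]mulrA [f c * (_ / _)]mulrC divfK //.
    under eq_bigr => j _ do rewrite !mxE -rmorphM mulrC.
    by rewrite -rmorph_sum -!rmorphM -mP.
  apply/eqP => /rowP z; apply: nzA => x; split=> [/sP[k ->]|->]; last exact: ideal0.
  apply: big1 => i _; have := z i; rewrite !mxE => /eqP.
  by rewrite tofrac_eq0 => /eqP->; rewrite mulr0.
case/(icD _ _ (char_poly_monic M)) => z zP; exists z.
apply/eqP; rewrite -tofrac_eq rmorphM /= -zP.
by rewrite mulrCA mulfV ?mulr1.
Qed.

Hypothesis dD : dedekind D.
Variable P : D -> Prop.
Hypothesis primeP : prime_ideal P.
Hypothesis nzP : ~ ideal_eq P zero_ideal.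

Let iP : ideal_of P. Proof. by case: primeP. Qed.

Lemma prime_nonzero_elt : exists2 c, P c & c != 0.
Proof.
apply: contrapT => n; apply: nzP => x; split=> [Px|->]; last exact: ideal0.
by apply/eqP; apply/negPn/negP => x0; apply: n; exists x.
Qed.

(* For [c] in [P], the prime [P] is an associated prime of [D/cD]: the maximal
   ideals of the form [(cD : y)] inside [P] are prime, hence equal to [P]. *)
Lemma prime_associated : exists c y, [/\ c != 0, ~ (exists z, y = c * z)
  & forall x, P x -> exists z, y * x = c * z].
Proof.
have [nD _ maxD] := dD.
have [_ P1 Pp] := primeP.
have [c Pc c0] := prime_nonzero_elt.
pose F y x := exists z, y * x = c * z.
have iF y : ideal_of (F y).
  split=> [|x x' [z E] [z' E']|d x [z E]].
  - by exists 0; rewrite !mulr0.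
  - by exists (z - z'); rewrite !mulrBr E E'.
  - by exists (d * z); rewrite mulrCA E mulrCA.
have [||y yP ymax] := @noetherian_maximal _ (fun y => ideal_sub (F y) P) F nD.
- by [].
- by exists 1 => x [z]; rewrite mul1r => ->; apply: idealMulr.
have pF : prime_ideal (F y).
  split=> // [/yP//|u v Fuv].
  have [?|nv] := pselect (F y v); [by right|left].
  (* Otherwise [F (y * u)] would lie in [P], and maximality of [F y] would put [v] in [F y]. *)
  have [s ys nPs] : exists2 s, F (y * u) s & ~ P s.
    apply: contrapT => n; apply: nv.
    apply: (ymax (y * u)); first by move=> s Fs; apply: contrapT => nPs; apply: n; exists s.
      by move=> x [z E]; exists (u * z); rewrite mulrAC E mulrAC mulrA.
    by case: Fuv => z; exists z; rewrite -mulrA.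
  (* [F (y * s)] stays inside [P] because [s] is outside [P]; it contains [u], and maximality brings
     it back into [F y]. *)
  apply: (ymax (y * s)).
  - move=> x [z E]; have /yP/Pp[//|//] : F y (s * x) by exists z; rewrite mulrA.
  - by move=> x [z E]; exists (s * z); rewrite mulrAC E mulrAC mulrA.
  - by case: ys => z E; exists z; rewrite mulrAC.
have eqF : ideal_eq P (F y).
  have [|//|//] := maxD _ pF _ _ iP yP.
  by move=> /(_ c)[Fc _]; move/eqP: c0; apply; apply: Fc; exists y; rewrite mulrC.
exists c, y; split=> // [[z E]|x /eqF//].
by apply: P1; apply/eqF; exists z; rewrite mulr1.
Qed.

(* [P] becomes principal, generated by [p], after inverting [t]. *)
Lemma prime_locally_principal : exists p t,
  [/\ P p, ~ P t & forall x, P x -> exists y, t * x = p * y].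
Proof.
have [nD icD _] := dD.
have [c [b [c0 nb bP]]] := prime_associated.
(* If no such [p] existed, [b / c] would map [P] into itself and so lie in [D], against the choice
   of [b] and [c]. *)
have [p Pp [t E nt]] : exists2 p, P p & exists2 t, b * p = c * t & ~ P t.
  apply: contrapT => n; apply: nb.
  apply: (@integrally_closed_stable P) => //; first exact: nD.
  move=> x Px; have [z E] := bP x Px; exists z => //.
  by apply: contrapT => nz; apply: n; exists x => //; exists z.
exists p, t; split=> // x Px; have [z Ez] := bP x Px; exists z.
by apply: (mulfI c0); rewrite mulrA -E mulrAC Ez mulrC mulrCA mulrA.
Qed.

Lemma prime_max u : ~ P u -> exists v, P (1 - u * v).
Proof.
have [_ _ maxD] := dD; move=> nu.
pose Q := ideal_add P (fun x => exists v, x = u * v).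
have iu : ideal_of (fun x => exists v, x = u * v).
  split=> [|x y [v ->] [w ->]|c x [v ->]].
  - by exists 0; rewrite mulr0.
  - by exists (v - w); rewrite mulrBr.
  - by exists (c * v); rewrite mulrCA.
have [||E|[x [_ [Px [v ->] ->]]]] := maxD P primeP nzP Q.
- exact: ideal_add_ideal.
- by move=> x; apply: ideal_addl.
- by case: nu; apply/E; apply: ideal_addr => //; exists 1; rewrite mulr1.
- by exists v; rewrite addrK.
Qed.

(** An inverse modulo [P] lifts to [P^m]: the power [(1 - u * v) ^+ m] has the form [1 - u * w]. *)
Lemma unit_mod_exp u m : ~ P u -> exists v, ideal_exp P m (1 - u * v).
Proof.
move=> /prime_max[v /(@mem_ideal_exp _ _ _ m) Pv].
suff [w E] : exists w, (1 - u * v) ^+ m = 1 - u * w by exists w; rewrite -E.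
elim: m {Pv} => [|m [w E]]; first by exists 0; rewrite mulr0 subr0.
by exists (v + w - u * v * w); rewrite exprS E; ring.
Qed.

Lemma ideal_exp_cancel u x m : ~ P u -> ideal_exp P m (u * x) -> ideal_exp P m x.
Proof.
move=> /unit_mod_exp-/(_ m)[v Pv] Pux; have iPm := ideal_exp_ideal m iP.
rewrite (_ : x = x * (1 - u * v) + v * (u * x)); last by ring.
by apply: idealD => //; apply: idealMull.
Qed.

(** An element of exact order [m] generates [P^m] modulo any [P^k]: up to factors outside [P], which
    are invertible modulo [P^k], it equals [p^m]. *)
Lemma exp_principal d m k x :
  ideal_exp P m d -> ~ ideal_exp P m.+1 d -> ideal_exp P m x ->
  exists z, ideal_exp P k (x - d * z).
Proof.
have [p [t [Pp nt tP]]] := prime_locally_principal.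
have [_ nP1 Pprime] := primeP.
have nPX i : ~ P (t ^+ i).
  by elim: i => [|i IH] //; rewrite exprS => /Pprime[].
have tX y : ideal_exp P m y -> exists w, t ^+ m * y = p ^+ m * w.
  elim: m y => [|i IH] y; first by exists y.
  move: y; apply: ideal_mul_min.
    split=> [|y y' [w E] [w' E']|c y [w E]].
    - by exists 0; rewrite !mulr0.
    - by exists (w - w'); rewrite !mulrBr E E'.
    - by exists (c * w); rewrite mulrCA E mulrCA.
  move=> y y' /tP[w E] /IH[w' E']; exists (w * w').
  by rewrite !exprS mulrACA E E' mulrACA.
move=> Pd nPd Px; have [s Es] := tX d Pd; have [y Ey] := tX x Px.
have ns : ~ P s.
  move=> Ps; apply: nPd; apply: (@ideal_exp_cancel _ _ _ (nPX m)).
  by rewrite Es mulrC; apply: mem_ideal_mul => //; apply: mem_ideal_exp.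
have [|v Pv] := @unit_mod_exp (s * t ^+ m) k; first by case/Pprime => // /nPX.
(* Formally the quotient is [y / s]; [v] inverts [s * t ^+ m] modulo [P^k]. *)
exists (t ^+ m * y * v).
rewrite (_ : x - _ = x * (1 - s * t ^+ m * v)).
  by apply: idealMull => //; apply: ideal_exp_ideal.
have -> : d * (t ^+ m * y * v) = v * y * (t ^+ m * d) by ring.
rewrite Es (_ : v * y * (p ^+ m * s) = v * s * (p ^+ m * y)); last by ring.
by rewrite -Ey; ring.
Qed.

End Dedekind.

Lemma prime_comaximal (D : idomainType) (P Q : D -> Prop) : dedekind D ->
  prime_ideal P -> ~ ideal_eq P zero_ideal ->
  prime_ideal Q -> ~ ideal_eq Q zero_ideal -> ~ ideal_eq P Q -> comaximal P Q.
Proof.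
move=> dD pP nzP pQ nzQ nPQ; have [iQ nQ1 _] := pQ; have [iP nP1 _] := pP.
have [x Qx nPx] : exists2 x, Q x & ~ P x.
  apply: contrapT => n.
  have QP : ideal_sub Q P by move=> x Qx; apply: contrapT => nPx; apply: n; exists x.
  by have [_ _ maxD] := dD; case: (maxD Q pQ nzQ P iP QP).
have [v Pv] := prime_max dD pP nzP nPx.
by exists (1 - x * v), (x * v); rewrite subrK; split=> //; apply: idealMulr.
Qed.

(** * Newton expansions in one variable *)

Section Newton.
Variable D : idomainType.
Implicit Types (A M X : D -> Prop) (b c : nat -> D).

(** The bound [N] is left free so that expansions of different degrees can share one index range
    when they are multiplied across variables. *)
Lemma newton_expansion b c k : exists g : nat -> D,
  [/\ g k = 1, forall j, (k < j)%N -> g j = 0 &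
      forall x N, (k < N)%N ->
        \prod_(j < k) (x - c j) = \sum_(j < N) g j * \prod_(i < j) (x - b i)].
Proof.
suff [g [g1 g0 gE]] : exists g : nat -> D,
    [/\ g k = 1, forall j, (k < j)%N -> g j = 0 &
      forall x, \prod_(j < k) (x - c j) = \sum_(j < k.+1) g j * \prod_(i < j) (x - b i)].
  exists g; split=> // x N /subnKC <-.
  elim: (N - k.+1)%N => [|m ->]; first by rewrite addn0 gE.
  by rewrite addnS [RHS]big_ord_recr /= [g (_ + _)%N]g0 ?mul0r ?addr0 ?leq_addr.
elim: k => [|k [g [g1 g0 gE]]].
  exists (fun j => (j == 0%N)%:R); split=> // [[]//|x].
  by rewrite big_ord_recl !big_ord0 mulr1 addr0.
(* Multiplying the [j]-th term by [x - c k = (x - b j) + (b j - c k)] gives a shift plus a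
   scaling. *)
exists (fun j => (if j is j'.+1 then g j' else 0) + g j * (b j - c k)); split.
- by rewrite g1 [g _]g0 ?mul0r ?addr0.
- by case=> // j kj; rewrite !g0 ?mul0r ?addr0 // ltnW.
move=> x; rewrite big_ord_recr /= gE mulr_suml.
under [RHS]eq_bigr do rewrite mulrDl.
rewrite big_split /= [X in _ = X + _]big_ord_recl mul0r add0r.
rewrite [X in _ = _ + X]big_ord_recr /= [g k.+1]g0 // !mul0r addr0 -big_split.
by apply: eq_bigr => j _ /=; rewrite /bump /= add1n big_ord_recr /=; ring.
Qed.

Definition newton_diag b k := \prod_(j < k) (b k - b j).

(* What a [P]-ordering [b] of [X] retains modulo a power [A] of [P]. *)
Definition local_ordering A X b :=
  (forall j, X (b j)) /\
  forall k x, X x -> exists z, A (\prod_(j < k) (x - b j) - newton_diag b k * z).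

Lemma falling_eq0 b k j : (j < k)%N -> \prod_(i < k) (b j - b i) = 0.
Proof. by move=> jk; rewrite (bigD1 (Ordinal jk)) //= subrr mul0r. Qed.

(** Expand the monic polynomial with roots [c j] along [b] and evaluate at [b 0], [b 1], and so on:
    each [g j * newton_diag b j] lies in [A] in turn, and the leading coefficient [g k] is [1]. *)
Lemma newton_diag_vanish A X b c k : ideal_of A -> local_ordering A X b ->
  (forall x, X x -> A (\prod_(j < k) (x - c j))) -> A (newton_diag b k).
Proof.
move=> iA [Xb bP] cP; have [g [g1 g0 gE]] := newton_expansion b c k.
suff H j : (j <= k)%N -> A (g j * newton_diag b j) by move: (H k (leqnn k)); rewrite g1 mul1r.
elim/ltn_ind: j => j IH jk.
have jk1 : (j < k.+1)%N by [].
have := cP _ (Xb j); rewrite (gE _ k.+1) // (bigD1 (Ordinal jk1)) //=.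
move=> /(ideal_congr iA); apply; rewrite opprD addNKr.
apply: idealN => //; apply: ideal_sum => // i ij.
have [lij|lji|eij] := ltngtP i j; last by case/eqP: ij; apply: val_inj.
- have [z Az] := bP i _ (Xb j).
  apply: (@ideal_congr _ A _ (g i * (newton_diag b i * z))) => //.
    exact: congrMl.
  rewrite mulrA. apply: idealMulr => //; apply: IH => //; apply: leq_trans (ltnW lij) jk.
- by rewrite falling_eq0 // mulr0; apply: ideal0.
Qed.

End Newton.

(** * Newton sums in several variables *)

Section MultivariateNewton.
Variables (D : idomainType) (r : nat).
Implicit Types (A M : D -> Prop) (X : 'I_r -> D -> Prop) (a b : 'I_r -> nat -> D).
Implicit Types (c : {ffun 'I_r -> nat} -> D) (k : {ffun 'I_r -> nat}) (x : 'I_r -> D).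

Definition mdiag b k := \prod_(i < r) newton_diag (b i) (k i).

Lemma mfalling_congr A a b k x : ideal_of A -> (forall i j, A (a i j - b i j)) ->
  A (mfalling a k x - mfalling b k x).
Proof.
move=> iA ab; apply: congr_prod => // i; apply: congr_prod => // j.
rewrite (_ : _ - _ = b i j - a i j); first exact: congr_sym.
by ring.
Qed.

Lemma mfalling_mdiag A X a b k x : ideal_of A -> (forall i j, A (a i j - b i j)) ->
  (forall i, local_ordering A (X i) (b i)) -> in_domain X x ->
  exists z, A (mfalling a k x - mdiag b k * z).
Proof.
move=> iA ab bP Xx.
have H i : exists z, A (falling b i (k i) (x i) - newton_diag (b i) (k i) * z).
  by have [_ /(_ (k i) (x i) (Xx i))] := bP i.
have [z zP] := choice H; exists (\prod_i z i).
apply: congr_trans (mfalling_congr _ _ iA ab) _ => //.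
by rewrite -big_split; apply: congr_prod.
Qed.

(** Triangularity of the Newton basis at the points [b i (k i)]. Two ideals appear because [a] and
    [b] agree modulo [A], while the sums are only known modulo the larger [M]. *)
Lemma newton_coef A M X a b (s : seq {ffun 'I_r -> nat}) c :
  ideal_of A -> ideal_of M -> ideal_sub A M -> uniq s ->
  (forall i j, A (a i j - b i j)) -> (forall i, local_ordering A (X i) (b i)) ->
  (forall x, in_domain X x -> M (\sum_(k <- s) c k * mfalling a k x)) ->
  forall k, k \in s -> M (c k * mdiag b k).
Proof.
move=> iA iM AM us ab bP cP k.
have [m] := ubnP (\sum_i k i); elim: m k => // m IH k km ks.
pose x i := b i (k i).
have Xx : in_domain X x by move=> i; have [Xb _] := bP i; apply: Xb.
have abc k' : M (c k' * mfalling a k' x - c k' * mfalling b k' x).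
  by apply: congrMl => //; apply: AM; apply: mfalling_congr.
have := cP x Xx; rewrite (bigD1_seq k) //= => cPx.
have {}abk : M (c k * mdiag b k - c k * mfalling a k x) := congr_sym iM (abc k).
apply: ideal_congr abk _ => //; apply: ideal_congr cPx => //.
rewrite opprD addNKr; apply: idealN => //.
rewrite big_seq_cond; apply: ideal_sum => // k' /andP[k's k'k].
(* Indices componentwise below [k] have smaller total degree and fall to induction; any other has
   some [k i < k' i], and the corresponding falling product along [b] vanishes at [x i]. *)
have [/forallP le|] := boolP [forall i, k' i <= k i]%N.
  have [z Az] := mfalling_mdiag k' iA ab bP Xx.
  apply: (@ideal_congr _ M _ (c k' * (mdiag b k' * z))) => //.
    by apply: congrMl => //; apply: AM.
  rewrite mulrA; apply: idealMulr => //; apply: IH => //.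
  rewrite -ltnS; apply: leq_trans km; rewrite ltnS.
  have [i ik] : exists i, k' i != k i.
    by apply/existsP; rewrite -negb_forall; apply: contraNN k'k => /eqfunP/ffunP/eqP.
  rewrite (bigD1 i) // [X in (_ < X)%N](bigD1 i) //= -addSn.
  by apply: leq_add; [rewrite ltn_neqAle ik le|apply: leq_sum].
rewrite negb_forall => /existsP[i]; rewrite -ltnNge => ik.
apply: ideal_congr (abc k') _ => //.
by rewrite /mfalling (bigD1 i) //= /falling falling_eq0 // mul0r mulr0; apply: ideal0.
Qed.

Lemma monomial_newton a k : exists G : seq (D * {ffun 'I_r -> nat}),
  forall x, \prod_(i < r) x i ^+ k i = \sum_(m <- G) m.1 * mfalling a m.2 x.
Proof.
(* A power of [x i] is a falling product whose roots are all [0]. *)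
have [g gP] := choice (fun i => newton_expansion (a i) (fun=> 0) (k i)).
pose N := (\max_i k i).+1.
pose h (f : {ffun 'I_r -> 'I_N}) := (\prod_i g i (f i), [ffun i => f i : nat]).
exists [seq h f | f <- enum {ffun 'I_r -> 'I_N}] => x.
rewrite big_map big_enum /=.
transitivity (\prod_i \sum_(j < N) g i j * falling a i j (x i)).
  apply: eq_bigr => i _; have [_ _ /(_ (x i) N)] := gP i.
  rewrite prodr_const card_ord subr0; apply.
  by rewrite ltnS (leq_bigmax i).
rewrite bigA_distr_bigA; apply: eq_bigr => f _ /=.
by rewrite big_split /=; congr (_ * _); apply: eq_bigr => i _; rewrite ffunE.
Qed.

Lemma polynomial_newton a (F : seq (D * {ffun 'I_r -> nat})) :
  exists G : seq (D * {ffun 'I_r -> nat}),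
  forall x, eval_mpoly F x = \sum_(m <- G) m.1 * mfalling a m.2 x.
Proof.
elim: F => [|[c k] F [G GP]].
  by exists [::] => x; rewrite /eval_mpoly !big_nil.
have [H HP] := monomial_newton a k.
exists ([seq (c * m.1, m.2) | m <- H] ++ G) => x.
rewrite big_cat big_map /= -GP /eval_mpoly big_cons /= HP mulr_sumr.
by congr (_ + _); apply: eq_bigr => m _; rewrite mulrA.
Qed.

Definition coef_of (G : seq (D * {ffun 'I_r -> nat})) k := \sum_(m <- G | m.2 == k) m.1.

Lemma supported_coef_of G : supported (coef_of G) (map snd G).
Proof.
move=> k kG; rewrite /coef_of big_seq_cond big1 // => m /andP[mG /eqP E].
by case/negP: kG; rewrite -E map_f.
Qed.

Lemma eval_coef_of a G x :
  eval_family a (coef_of G) (map snd G) x = \sum_(m <- G) m.1 * mfalling a m.2 x.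
Proof.
rewrite /eval_family; under eq_bigr do rewrite mulr_suml.
rewrite (exchange_big_dep predT) //= big_seq [RHS]big_seq; apply: eq_bigr => m mG.
rewrite big_mkcond (bigD1_seq m.2) ?undup_uniq ?mem_undup ?map_f //= eqxx big1 ?addr0 // => k.
by rewrite eq_sym => /negPf->.
Qed.

(** Moves the sum to any list covering the support, so that two families can be subtracted over a
    common list. *)
Lemma eval_supported a c L s x : supported c L -> uniq s ->
  (forall k, k \notin s -> c k = 0) ->
  eval_family a c L x = \sum_(k <- s) c k * mfalling a k x.
Proof.
move=> cL us cs; rewrite /eval_family.
rewrite (bigID (mem s)) /= addrC big1 ?add0r; last by move=> k /cs->; rewrite mul0r.
rewrite [RHS](bigID (mem (undup L))) /= [X in _ = _ + X]big1 ?addr0; last first.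
  by move=> k; rewrite mem_undup => /cL->; rewrite mul0r.
rewrite -big_filter -[RHS]big_filter; apply: perm_big.
apply: uniq_perm; rewrite ?filter_uniq ?undup_uniq // => k.
by rewrite !mem_filter andbC.
Qed.

End MultivariateNewton.

(** * Products in [R] of ideals that are principal modulo [A] *)

Section PrincipalModulo.
Variables (D : idomainType) (K A : D -> Prop).
Hypotheses (iK : ideal_of K) (iA : ideal_of A) (KA : ideal_sub K A).
Implicit Types (Q : D -> Prop) (d : D).

Definition principal_mod d : D -> Prop := fun y => exists z, A (y - d * z).

Lemma principal_mod_ideal d : ideal_of (principal_mod d).
Proof.
split=> [|x y [z Az] [w Aw]|c x [z Az]].
- by exists 0; rewrite mulr0; apply: congr_refl.
- exists (z - w); rewrite (_ : _ - _ = (x - d * z) - (y - d * w)); last by ring.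
  exact: idealB.
- exists (c * z); rewrite (_ : _ - _ = c * (x - d * z)); last by ring.
  exact: idealMull.
Qed.

Lemma principal_mod_sub d : ideal_sub A (principal_mod d).
Proof. by move=> x Ax; exists 0; rewrite mulr0 subr0. Qed.

Lemma Rprod_principal_mod (T : Type) (s : seq T) (Q : T -> D -> Prop) (d : T -> D) :
  (forall t, ideal_sub (Q t) (principal_mod (d t))) ->
  ideal_sub (Rprod K [seq Q t | t <- s]) (principal_mod (\prod_(t <- s) d t)).
Proof.
move=> Qd; elim: s => [|t s IH] y /=.
  by exists y; rewrite big_nil mul1r; apply: congr_refl.
have iM := principal_mod_ideal (\prod_(u <- t :: s) d u).
case=> [u [k [Qu Kk ->]]]; apply: idealD => //; last exact/principal_mod_sub/KA.
apply: (ideal_mul_min iM) Qu => p q /Qd[z Az] /IH[w Aw].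
by exists (z * w); rewrite big_cons mulrACA; apply: congrM.
Qed.

(** Converse half of [Rprod_principal_mod]: together they say that the product is generated modulo
    [A] by the product of the local generators. *)
Lemma Rprod_generator (T : Type) (s : seq T) (Q : T -> D -> Prop) (d : T -> D) :
  (forall t, exists2 y, Q t y & A (d t - y)) ->
  exists2 y, Rprod K [seq Q t | t <- s] y & A (\prod_(t <- s) d t - y).
Proof.
move=> Qd; elim: s => [|t s [y Qy Ay]] /=.
  by exists 1; rewrite ?big_nil //; apply: congr_refl.
have [z Qz Az] := Qd t; exists (z * y); last by rewrite big_cons; apply: congrM.
by apply: ideal_addl => //; apply: mem_ideal_mul.
Qed.

End PrincipalModulo.

(** * Powers of one prime in [R] and its P-orderings *)

Section ResiduePowers.
Variables (D : idomainType) (K P : D -> Prop) (e : nat).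
Hypotheses (iK : ideal_of K) (iP : ideal_of P) (KPe : ideal_sub K (ideal_exp P e)).
Implicit Types (X : D -> Prop) (b : nat -> D).

Lemma Rexp_ideal m : ideal_of (Rexp K P m).
Proof.
by case: m => [|m] //; apply: ideal_add_ideal => //; apply: ideal_mul_ideal.
Qed.

Lemma Rexp_sub m : (m <= e)%N -> ideal_sub (Rexp K P m) (ideal_exp P m).
Proof.
elim: m => [|m IH] // me x [y [z [+ Kz ->]]] => Py.
apply: idealD; first exact: ideal_exp_ideal.
  apply: ideal_mul_min Py; first exact: ideal_exp_ideal.
  by move=> p q Pp Rq; apply: mem_ideal_mul => //; apply: IH => //; apply: ltnW.
by apply: (ideal_exp_le iP me); apply: KPe.
Qed.

Lemma exp_Rexp m : ideal_sub (ideal_exp P m) (Rexp K P m).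
Proof.
elim: m => [|m IH] // x; apply: ideal_mul_min; first exact: (Rexp_ideal m.+1).
by move=> p q Pp /IH Rq; apply: ideal_addl => //; apply: mem_ideal_mul.
Qed.

Lemma Rexp_idempotent u m : P u -> K (u - u * u) -> Rexp K P m u.
Proof.
move=> Pu Ku; elim: m => [|m IH] //.
by exists (u * u), (u - u * u); split=> //; [exact: mem_ideal_mul|rewrite addrC subrK].
Qed.

Lemma wP_self d : wP K P d d. Proof. by split. Qed.

Lemma vseqP_diag b k : vseqP K P b k (newton_diag b k).
Proof. by case: k => [|k] //; apply: wP_self. Qed.

(** An idempotent of [R] lying in [P] lies in all powers of [P], hence in [wP] of any nonzero
    element. This supplies elements congruent to [1] in the factors at the other primes. *)
Lemma vseqP_idempotent b k u :
  P u -> K (u - u * u) -> ~ K (newton_diag b k) -> vseqP K P b k u.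
Proof.
by move=> Pu Ku; case: k => [|k] // nK; split=> // _ m _; apply: Rexp_idempotent.
Qed.

Lemma Pordering_vanish X b k x :
  is_Pordering K P X b -> K (newton_diag b k) -> X x -> K (\prod_(j < k) (x - b j)).
Proof.
by move=> [_ bP] Kd Xx; have [+ _] := bP k x Xx _ (wP_self _); apply.
Qed.

Hypotheses (dD : dedekind D) (primeP : prime_ideal P).
Hypothesis nzP : ~ ideal_eq P zero_ideal.

(** If [d] lies in [K] or in [P^e], all of [wP] lies in [P^e]; otherwise [d] has an exact order
    [m < e] and [exp_principal] applies. *)
Lemma wP_principal_mod d : ideal_sub (wP K P d) (principal_mod (ideal_exp P e) d).
Proof.
move=> x [Kd nKd].
have [/Kd Kx|/nKd{}Kd] := pselect (K d).
  by apply: principal_mod_sub; apply: KPe.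
have [Pd|nPd] := pselect (ideal_exp P e d).
  by apply/principal_mod_sub/(Rexp_sub (leqnn e))/Kd/exp_Rexp.
have [m [me Pmd nPmd]] :
    exists m, [/\ (m < e)%N, ideal_exp P m d & ~ ideal_exp P m.+1 d].
  elim: (e) nPd => [[]//|m IH] nPd.
  have [?|/IH[k [km ? ?]]] := pselect (ideal_exp P m d); first by exists m.
  by exists k; split=> //; apply: ltnW.
apply: (exp_principal dD) nPmd _ => //.
by apply/(Rexp_sub (ltnW me))/Kd/exp_Rexp.
Qed.

Lemma vseqP_principal_mod b k :
  ideal_sub (vseqP K P b k) (principal_mod (ideal_exp P e) (newton_diag b k)).
Proof.
case: k => [|k]; last exact: wP_principal_mod.
move=> x _; exists x; rewrite /newton_diag big_ord0 mul1r.
by apply: congr_refl; apply: ideal_exp_ideal.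
Qed.

Lemma Pordering_local X b :
  is_Pordering K P X b -> local_ordering (ideal_exp P e) X b.
Proof.
move=> [Xb bP]; split=> // k x Xx.
exact/wP_principal_mod/bP/wP_self.
Qed.

End ResiduePowers.

(** * Factorial ideals localised at the prime power factors of [K] *)

Section Factorials.
Variables (D : idomainType) (n : nat) (P : 'I_n -> D -> Prop) (e : 'I_n -> nat).
Variable K : D -> Prop.
Hypotheses (dD : dedekind D) (iK : ideal_of K).
Hypothesis primeP : forall l, prime_ideal (P l) /\ ~ ideal_eq (P l) zero_ideal.
Hypothesis neqP : forall l l', l != l' -> ~ ideal_eq (P l) (P l').
Hypothesis e_gt0 : forall l, (0 < e l)%N.
Let A l := ideal_exp (P l) (e l).
Hypothesis KE : ideal_eq K (ideal_prod [seq A l | l <- enum 'I_n]).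

Let iP l : ideal_of (P l). Proof. by have [[]] := primeP l. Qed.
Let iA l : ideal_of (A l). Proof. exact: ideal_exp_ideal. Qed.

Lemma comaximal_factors l l' : l != l' -> comaximal (A l) (A l').
Proof.
move=> ll'; apply: comaximal_exp2 => //.
have [? ?] := primeP l; have [? ?] := primeP l'.
by apply: prime_comaximal => //; apply: neqP.
Qed.

Lemma modulus_sub_factor l : ideal_sub K (A l).
Proof. by move=> x /KE; apply: ideal_prod_sub => //; rewrite mem_enum. Qed.

Lemma mem_local (J : D -> Prop) x : ideal_of J -> ideal_sub K J ->
  (forall l, ideal_add J (A l) x) -> J x.
Proof.
move=> iJ KJ Jx; apply: (ideal_local iA (enum_uniq 'I_n)) => //.
- exact: comaximal_factors.
- by move=> y Ay; apply/KJ/KE.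
Qed.

Lemma mem_modulus x : (forall l, A l x) -> K x.
Proof. by move=> Ax; apply: mem_local => // l; apply: ideal_addr. Qed.

(** Chinese remaindering: split [1] between [A l] and the product of the other factors; the part in
    [A l] is idempotent modulo [K]. *)
Lemma factor_idempotent l :
  exists u, [/\ P l u, K (u - u * u) & forall l', l' != l -> A l' (1 - u)].
Proof.
have [u [w [Au + E]]] : comaximal (A l)
    (ideal_prod [seq A l' | l' <- [seq l' <- enum 'I_n | l' != l]]).
  by apply: comaximal_prod => // l'; rewrite mem_filter eq_sym => /andP[/comaximal_factors].
rewrite (_ : w = 1 - u); last by rewrite E addrAC subrr add0r.
move=> Aw; have {}Aw l' : l' != l -> A l' (1 - u).
  by move=> l'l; apply: ideal_prod_sub Aw => //; rewrite mem_filter l'l mem_enum.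
exists u; split=> //.
  have /= := ideal_exp_le (iP l) (e_gt0 l) Au.
  exact: (ideal_mul_subl (iP l)).
rewrite (_ : u - u * u = u * (1 - u)); last by ring.
apply: mem_modulus => l'; have [->|/Aw] := eqVneq l' l; first exact: idealMulr.
exact: idealMull.
Qed.

Variables (X : D -> Prop) (b : 'I_n -> nat -> D).
Hypothesis bP : forall l, is_Pordering K (P l) X (b l).

Lemma newton_diag_modulus l l' k :
  K (newton_diag (b l') k) -> A l (newton_diag (b l) k).
Proof.
move=> Kd; have [pP nzP] := primeP l.
apply: newton_diag_vanish => //.
  by apply: (Pordering_local iK _ _ dD pP nzP (bP l)) => //; apply: modulus_sub_factor.
move=> x Xx; apply: modulus_sub_factor.
exact: Pordering_vanish (bP l') Kd Xx.
Qed.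

(** Pads a single factor with ones, so that the lemmas on [Rprod] apply to one prime at a time. *)
Let prod_if l (d : D) : \prod_(l' <- enum 'I_n) (if l' == l then d else 1) = d.
Proof.
by rewrite big_enum (bigD1 l) //= eqxx big1 ?mulr1 // => l' /negPf->.
Qed.

Lemma vfact_principal_mod l k :
  ideal_sub (vfact K P b k) (principal_mod (A l) (newton_diag (b l) k)).
Proof.
rewrite -[newton_diag _ _](prod_if l); apply: Rprod_principal_mod => //.
  exact: modulus_sub_factor.
move=> l' y; case: eqP => [->|_ _]; last by exists y; rewrite mul1r; apply: congr_refl.
have [pP nzP] := primeP l.
by apply: vseqP_principal_mod => //; apply: modulus_sub_factor.
Qed.

(* When some P-sequence has already collapsed to the zero ideal of [R], the
   monic polynomial with roots [b l0 j] vanishes on [X], so every other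
   P-sequence is trivial modulo its own prime power. *)
Lemma vfact_generator l k :
  exists2 y, vfact K P b k y & A l (newton_diag (b l) k - y).
Proof.
have [[l0 Kl0]|nK] := pselect (exists l0, K (newton_diag (b l0) k)).
  exists 0; last by rewrite subr0; apply: newton_diag_modulus Kl0.
  rewrite /vfact; case: (enum 'I_n) => [|l1 s] //=.
  by exists 0, 0; rewrite addr0; split=> //; [exists [::]; rewrite big_nil|exact: ideal0].
rewrite -[newton_diag _ _](prod_if l); apply: Rprod_generator => // l'.
have [->|l'l] := eqVneq l' l.
  by exists (newton_diag (b l) k); [exact: vseqP_diag|exact: congr_refl].
have [u [Pu Ku /(_ l)Au]] := factor_idempotent l'; exists u; last by apply: Au; rewrite eq_sym.
by apply: vseqP_idempotent => // Kl'; apply: nK; exists l'.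
Qed.

(** A repeated term in a single P-ordering thus makes the whole factorial ideal zero in [R]. *)
Lemma vfact_modulus l0 k : K (newton_diag (b l0) k) -> ideal_sub (vfact K P b k) K.
Proof.
move=> Kd y vy; apply: mem_modulus => l.
have [z Az] := vfact_principal_mod l vy.
by apply: ideal_congr Az _ => //; apply: idealMulr => //; apply: newton_diag_modulus Kd.
Qed.

End Factorials.

(** * Existence and uniqueness of the Newton representation *)

Unset Implicit Arguments.

Theorem mainTheorem2 (D : idomainType) (r : nat)
  (I : 'I_r -> D -> Prop) (J : D -> Prop) (Dres : 'I_r -> D -> Prop)
  (n : nat) (P : 'I_n -> D -> Prop) (e : 'I_n -> nat)
  (al : 'I_n -> 'I_r -> nat -> D) (a : 'I_r -> nat -> D)
  (f : ('I_r -> D) -> D) :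
  dedekind D -> (0 < r)%N ->
  (forall i, proper_nonzero (I i)) -> proper_nonzero J ->
  (forall i, residue_system (I i) (Dres i)) ->
  (forall l, prime_ideal (P l) /\ ~ ideal_eq (P l) (@zero_ideal D)) ->
  (forall l l', l != l' -> ~ ideal_eq (P l) (P l')) ->
  (forall l, (0 < e l)%N) ->
  ideal_eq (lcm_ideal I J) (ideal_prod [seq ideal_exp (P l) (e l) | l <- enum 'I_n]) ->
  (forall l i, is_Pordering (lcm_ideal I J) (P l) (Dres i) (al l i) /\ al l i 0%N = 0) ->
  (forall i, a i 0%N = 0 /\
     forall j l, Rexp (lcm_ideal I J) (P l) (e l) (a i j - al l i j)) ->
  poly_function J Dres f ->
  let K := lcm_ideal I J in
  let v := fun (i : 'I_r) (k : nat) => vfact K P (fun l => al l i) k in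
  let inS := fun k : {ffun 'I_r -> nat} => forall i, lt_mu (v i) J (Dres i) (k i) in
  exists (b : {ffun 'I_r -> nat} -> D) (L : seq {ffun 'I_r -> nat}),
    [/\ supported b L, (forall k, ~ inS k -> b k = 0),
        represents J Dres f a b L &
        forall (b' : {ffun 'I_r -> nat} -> D) (L' : seq {ffun 'I_r -> nat}),
          supported b' L' -> (forall k, ~ inS k -> b' k = 0) ->
          (represents J Dres f a b' L' <->
           forall k, inS k ->
             annJ J (Rprod K [seq v i (k i) | i <- enum 'I_r]) (b k - b' k))].
Proof.
move=> dD _ properI properJ _ primeP neqP e_gt0 KE ordal aE [F FE] K v inS.
have [iJ _ J1] := properJ.
have iI i : ideal_of (I i) by have [] := properI i.
have iK : ideal_of K.
  split=> [|x y [Ix Jx] [Iy Jy]|c x [Ix Jx]]; split=> [i|]; try exact: ideal0.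
  - exact: idealB.
  - exact: idealB.
  - exact: idealMull.
  - exact: idealMull.
have KJ : ideal_sub K J by move=> x [].
pose A l := ideal_exp (P l) (e l).
have iP l : ideal_of (P l) by have [[]] := primeP l.
have iA l : ideal_of (A l) by apply: ideal_exp_ideal.
have KA l : ideal_sub K (A l) by apply: modulus_sub_factor KE _.
have ord i l : is_Pordering K (P l) (Dres i) (al l i) by have [] := ordal l i.
have ab l i j : A l (a i j - al l i j).
  by have [_ /(_ j l)] := aE i; apply: (Rexp_sub (iP l) (KA l)).
have lo l i : local_ordering (A l) (Dres i) (al l i).
  by have [pP nzP] := primeP l; apply: (Pordering_local iK (iP l) (KA l)).
pose V (k : {ffun 'I_r -> nat}) := Rprod K [seq v i (k i) | i <- enum 'I_r].
(* With [Vlow], this makes [mdiag (al l) k] a generator of [V k] modulo [A l], so [annE] can test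
   the annihilator on one element per prime. *)
have Vup l k : ideal_sub (V k) (principal_mod (A l) (mdiag (al l) k)).
  rewrite /mdiag -big_enum; apply: Rprod_principal_mod => // i.
  exact: (vfact_principal_mod dD iK primeP KE).
have Vlow l k : exists2 y, V k y & A l (mdiag (al l) k - y).
  rewrite /mdiag -big_enum; apply: Rprod_generator => // i.
  exact: (vfact_generator dD iK primeP neqP e_gt0 KE (ord i)).
have memJ x : (forall l, ideal_add J (A l) x) -> J x.
  exact: (mem_local dD primeP neqP KE iJ KJ).
have iJA l : ideal_of (ideal_add J (A l)) by apply: ideal_add_ideal.
have AJ l : ideal_sub (A l) (ideal_add J (A l)) by move=> x; apply: ideal_addr.
have annE k c : annJ J (V k) c <->
    forall l, ideal_add J (A l) (c * mdiag (al l) k).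
  split=> [cV l|cd y Vy].
    have [y Vy Ay] := Vlow l k.
    exists (c * y), (c * (mdiag (al l) k - y)); split; first exact: cV.
      exact: idealMull.
    by ring.
  apply: memJ => l; have [z Az] := Vup l k y Vy.
  apply: (@ideal_congr _ _ _ (c * (mdiag (al l) k * z))) => //.
    by apply: congrMl => //; apply: AJ.
  by rewrite mulrA; apply: idealMulr.
have notS k x : ~ inS k -> in_domain Dres x -> J (mfalling a k x).
  move=> /existsNP[i nlt] Dx.
  (* If no such [k'] existed, the first clause of [lt_mu] would hold outright, and the second too,
     because the first [(k i).+1] terms of a P-ordering would be distinct. *)
  have [k' [k'gt0 k'k vk']] : exists k', [/\ (0 < k')%N, (k' <= k i)%N & ideal_sub (v i k') J].
    apply: contrapT => nk'; apply: nlt; split=> [_ k' k'0 k'k vk'|_].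
      by apply: nk'; exists k'.
    (* Some prime is needed to have a P-ordering at hand; with none, the local test is empty and
       yields [J 1]. *)
    have [l _|n0] := pickP (@predT 'I_n); last first.
      case: J1; apply: memJ => l; by have := n0 l.
    exists [seq al l i j | j <- iota 0 (k i).+1]; split.
    (* A repetition at [j' < j] makes [newton_diag] zero at [j], so the [j]-th factorial ideal lies
       in [K], hence in [J], with [0 < j <= k i]. *)
    - apply: contrapT => /negP/(uniqPn 0)[j' [j [j'j]]].
      rewrite size_map size_iota => jk; have j'k := ltn_trans j'j jk.
      rewrite !(nth_map 0%N) ?size_iota // !nth_iota // !add0n.
      move=> Ejj'; apply: nk'; exists j; split=> //; first exact: leq_ltn_trans j'j.
      move=> y /= vy; apply: KJ; move: vy.
      apply: (vfact_modulus dD iK primeP neqP KE (ord i) (l0 := l)).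
      rewrite /newton_diag (bigD1 (Ordinal j'j)) //= Ejj' subrr mul0r.
      exact: ideal0.
    - by rewrite size_map size_iota.
    - by move=> y /mapP[j _ ->]; have [+ _] := ord i l; apply.
  rewrite /mfalling (bigD1 i) //=; apply: idealMulr => //.
  (* Only the first [k'] factors matter: their product is already in [J]. *)
  rewrite /falling -(subnKC k'k) big_split_ord /=; apply: idealMulr => //.
  apply: memJ => l; have [_ /(_ k' (x i) (Dx i))[z Az]] := lo l i.
  have [y vy Ay] := vfact_generator dD iK primeP neqP e_gt0 KE (ord i) l k'.
  apply: (@ideal_congr _ _ _ (newton_diag (al l i) k' * z)) => //.
    apply: AJ; apply: congr_trans Az => //; apply: congr_prod => // j.
    rewrite (_ : _ - _ = al l i j - a i j); first exact: congr_sym.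
    by ring.
  apply: idealMulr => //; apply: (@ideal_congr _ _ _ y) => //; first exact: AJ.
  by apply: ideal_addl => //; apply: vk'.
have [G GE] := polynomial_newton a F.
(* By [notS] the discarded terms take values in [J] on the residue systems. *)
pose G' := [seq m <- G | `[< inS m.2 >]].
have supG' := @supported_coef_of _ _ G'.
have repG' : represents J Dres f a (coef_of G') (map snd G').
  move=> x Dx; rewrite eval_coef_of big_filter.
  apply: congr_trans (FE x Dx) => //.
  rewrite GE [X in _ - X](bigID (fun m => `[< inS m.2 >])) /=.
  rewrite opprD addNKr; apply: idealN => //.
  by apply: ideal_sum => // m /asboolPn mS; apply: idealMull => //; apply: notS.
have offS k : ~ inS k -> coef_of G' k = 0.
  move=> nS; apply: supG'; apply/mapP => -[m + E]; rewrite mem_filter -E.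
  by case/andP => /asboolP.
exists (coef_of G'), (map snd G'); split=> // b' L' supb' offb'.
pose s := undup (map snd G' ++ L').
pose c k := coef_of G' k - b' k.
have evalB x : eval_family a (coef_of G') (map snd G') x - eval_family a b' L' x =
    \sum_(k <- s) c k * mfalling a k x.
  rewrite !(@eval_supported _ _ _ _ _ s) ?undup_uniq //.
  - by rewrite -sumrB; apply: eq_bigr => k _; rewrite mulrBl.
  - by move=> k; rewrite mem_undup mem_cat negb_or => /andP[_ /supb'].
  - by move=> k; rewrite mem_undup mem_cat negb_or => /andP[/supG'].
have cs k : k \notin s -> c k = 0.
  rewrite mem_undup mem_cat negb_or => /andP[/supG' + /supb'].
  by rewrite /c => -> ->; rewrite subrr.
(* Since [coef_of G'] represents [f], uniqueness becomes a statement about the difference family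
   [c]. *)
have repE : represents J Dres f a b' L' <->
    forall x, in_domain Dres x -> J (\sum_(k <- s) c k * mfalling a k x).
  split=> H x Dx.
    rewrite -evalB; apply: congr_trans (repG' x Dx) _ => //.
    by apply: congr_sym => //; apply: H.
  by apply: congr_trans (repG' x Dx) => //; apply: congr_sym => //; rewrite evalB; apply: H.
split=> [/repE H k _|H].
  apply/annE => l; have [ks|/cs] := boolP (k \in s); last first.
    by rewrite /c => ->; rewrite mul0r; apply: ideal0.
  (* [newton_coef] is used with [M] equal to [J + A l]. *)
  have cJ x (Dx : in_domain Dres x) := ideal_addl (iA l) (H x Dx).
  exact: (newton_coef (iA l) (iJA l) (AJ l) (undup_uniq _) (ab l) (lo l) cJ).
apply/repE => x Dx; apply: ideal_sum => // k _.
have [kS|nS] := pselect (inS k); last first.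
  by rewrite /c offS // offb' // subrr mul0r; apply: ideal0.
apply: memJ => l; have [z Az] := mfalling_mdiag k (iA l) (ab l) (lo l) Dx.
apply: (@ideal_congr _ _ _ (c k * (mdiag (al l) k * z))) => //.
  by apply: congrMl => //; apply: AJ.
by rewrite mulrA; apply: idealMulr => //; have /annE := H k kS; apply.
Qed.
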